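(* The following four (the Abramovich formula, the integration formula, the Bloom--Owens algorithm, and the Budin--Cantor formula) all constitute equivalent methods for obtaining the coefficients of the power sum polynomial $S_k(n)$ in terms of the coefficients of $S_{k-1}(n)$: (A) Abramovich formula: $S_k(n) = n + k\, S_{k-1}^{\star}(n)$ for $n,k \geq 1$, where $S_{k-1}^{\star}(n)$ is the polynomial constructed by replacing in $S_{k-1}(n)$ the term $n^j$ with the expression $\frac{n^{j+1}-n}{j+1}$ for each $j=1,2,\ldots,k$. (B) Integration formula: $\displaystyle S_k(x) = k\int_0^x S_{k-1}(t)\,dt + \Big(1 - k\int_0^1 S_{k-1}(t)\,dt\Big)x$ for $k \geq 1$, with $S_0(x) = x$. (C) Bloom--Owens algorithm: (i) start with $S_{k-1}(n) = \sum_{j=1}^{k} a_{k-1,j} n^j$ with known coefficients $a_{k-1,j}$, $j=1,2,\ldots,k$; (ii) for each $j=2,3,\ldots,k+1$, set $a_{k,j} = \frac{k}{j}\, a_{k-1,j-1}$, which determines all the coefficients of $S_k(n)$ except $a_{k,1}$; (iii) since $S_k(1)=1$, obtain $a_{k,1}$ from $a_{k,1} = 1 - \sum_{j=2}^{k+1} a_{k,j}$, where the $a_{k,j}$ for $j=2,3,\ldots,k+1$ are those determined in step (ii). (D) Budin--Cantor formula: if $S_k(n) = b_1 n^{k+1} + b_2 n^k + b_3 n^{k-1} + \cdots + b_{k+1} n$, then $$S_{k+1}(n) = \frac{k+1}{k+2} b_1 n^{k+2} + \frac{k+1}{k+1} b_2 n^{k+1} + \frac{k+1}{k} b_3 n^{k}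 + \cdots + \frac{k+1}{2} b_{k+1} n^2 + \bigg[1 - (k+1)\sum_{i=1}^{k+1} \frac{b_i}{k+3-i}\bigg] n, \quad k \geq 0,$$ which allows one to compute $S_{k+1}(n)$ starting from $S_k(n)$ (or $S_k(n)$ starting from $S_{k-1}(n)$).
   Context: For integers $n,k \geq 1$, $S_k(n)$ denotes the power sum $1^k + 2^k + \cdots + n^k$, with $S_0(n) = n$. It can be represented by a polynomial in $n$ of degree $k+1$ with constant term zero, $S_k(n) = \sum_{j=1}^{k+1} a_{k,j} n^j$, with rational coefficients $a_{k,j}$. $S_k(x) = \sum_{j=1}^{k+1} a_{k,j} x^j$ denotes the polynomial obtained by replacing $n$ by the real variable $x$. *)

(* Defs.v *)
From HB Require Import structures.
From mathcomp Require Import all_boot all_order all_algebra.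
From mathcomp Require Import all_classical all_reals all_analysis.
From mathcomp Require Import ring.

Set Implicit Arguments.
Unset Strict Implicit.
Unset Printing Implicit Defensive.

Import Order.TTheory GRing.Theory Num.Theory.

Local Open Scope classical_set_scope.
Local Open Scope ring_scope.

Definition power_sum (k n : nat) : nat := (\sum_(1 <= i < n.+1) i ^ k)%N.

Definition represents_power_sum (k : nat) (p : {poly rat}) : Prop :=
  forall n : nat, (0 < n)%N -> p.[n%:R] = (power_sum k n)%:R.

(* Existence and uniqueness are [power_sum_polyP] and [power_sum_poly_unique];
   the default value 0 is never used. *)
Definition power_sum_poly (k : nat) : {poly rat} :=
  xget 0 [set p | represents_power_sum k p].

(* p = c_1 x + ... + c_d x^d *)
Definition has_form (d : nat) (p : {poly rat}) : Prop :=
  p`_0 = 0 /\ (size p <= d.+1)%N.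

(* In the four relations below, p plays the role of S_{k-1} and q that of S_k
   (in [budin_cantor], of S_k and S_{k+1}). *)

Definition star (k : nat) (p : {poly rat}) : {poly rat} :=
  \sum_(1 <= j < k.+1) p`_j *: (j.+1%:R^-1 *: ('X^(j.+1) - 'X)).

Definition abramovich (k : nat) (p q : {poly rat}) : Prop :=
  forall n : nat, (0 < n)%N -> q.[n%:R] = n%:R + k%:R * (star k p).[n%:R].

Definition evalR (R : realType) (p : {poly rat}) (x : R) : R :=
  (map_poly ratr p).[x].

(* The integral from a to b, with the usual sign convention when b < a. *)
Definition oriented_integral (R : realType) (a b : R) (f : R -> R) : R :=
  if a <= b then \int[lebesgue_measure]_(t in `[a, b]) f t
  else - \int[lebesgue_measure]_(t in `[b, a]) f t.

Definition integration_formula (R : realType) (k : nat) (p q : {poly rat}) :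
    Prop :=
  forall x : R,
    evalR q x = k%:R * oriented_integral 0 x (evalR p)
                + (1 - k%:R * oriented_integral 0 1 (@evalR R p)) * x.

Definition bloom_owens (k : nat) (p q : {poly rat}) : Prop :=
  [/\ has_form k.+1 q,
      forall j : nat, (2 <= j <= k.+1)%N -> q`_j = k%:R / j%:R * p`_j.-1
    & q`_1 = 1 - \sum_(2 <= j < k.+2) q`_j].

Definition budin_cantor (k : nat) (p q : {poly rat}) : Prop :=
  forall b : nat -> rat,
    (forall n : nat, (0 < n)%N ->
       p.[n%:R] = \sum_(1 <= i < k.+2) b i * n%:R ^+ (k + 2 - i)) ->
    forall n : nat, (0 < n)%N ->
      q.[n%:R] =
        \sum_(1 <= i < k.+2)
           (k.+1%:R / (k + 3 - i)%:R) * b i * n%:R ^+ (k + 3 - i)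
        + (1 - k.+1%:R * \sum_(1 <= i < k.+2) b i / (k + 3 - i)%:R) * n%:R.

Lemma poly_eq_nat (p q : {poly rat}) :
  (forall n : nat, (0 < n)%N -> p.[n%:R] = q.[n%:R]) -> p = q.
Proof.
move=> pq; apply/eqP; rewrite -subr_eq0; apply/negP => /negP nz.
pose s := [seq (i.+1)%:R | i <- iota 0 (size (p - q))] : seq rat.
have us : uniq s.
  by rewrite map_inj_uniq ?iota_uniq// => i j /eqP; rewrite eqr_nat => /eqP[].
have rs : all (root (p - q)) s.
  apply/allP => x /mapP[i _ ->]; rewrite rootE hornerD hornerN pq// subrr.
  by rewrite eqxx.
by have := max_poly_roots nz rs us; rewrite size_map size_iota ltnn.
Qed.

Lemma power_sum_poly_unique (k : nat) (p q : {poly rat}) :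
  represents_power_sum k p -> represents_power_sum k q -> p = q.
Proof. by move=> hp hq; apply: poly_eq_nat => n n0; rewrite hp// hq. Qed.

Lemma power_sum_rec (k n : nat) :
  (n.+1 ^ k.+1 = 1 + \sum_(j < k.+1) 'C(k.+1, j) * power_sum j n)%N.
Proof.
elim: n => [|n IH].
  by rewrite exp1n big1// => j _; rewrite /power_sum big_geq// muln0.
rewrite -[in LHS](addn1 n.+1) addnC expnDn big_ord_recr /= subnn binn exp1n.
rewrite !mul1n IH addnC -addnA -big_split /=; congr (_ + _)%N.
apply: eq_bigr => j _; rewrite exp1n mul1n -mulnDr; congr (_ * _)%N.
by rewrite /power_sum [in RHS]big_nat_recr.
Qed.

Lemma power_sum_poly_exists (k : nat) :
  exists p : {poly rat},
    [/\ represents_power_sum k p, p`_0 = 0 & size p = k.+2].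
Proof.
elim/ltn_ind: k => k IH.
have {}IH (j : 'I_k) : {p : {poly rat} |
    [/\ represents_power_sum j p, p`_0 = 0 & size p = j.+2]}.
  by apply: cid; exact: IH.
pose r : {poly rat} := \sum_(j < k) ('C(k.+1, j)%:R : rat) *: sval (IH j).
have szr : (size (r + 1)%R < k.+2)%N.
  rewrite ltnS (leq_trans (size_polyD _ _))// geq_max size_poly1 /= andbT.
  apply: (leq_trans (size_sum _ _ _)); apply/bigmax_leqP => j _.
  rewrite (leq_trans (size_scale_leq _ _))//.
  by case: (IH j) => p /= [_ _ ->]; rewrite ltnS.
have k0 : (k.+1%:R : rat) != 0 by rewrite pnatr_eq0.
have szX : size (('X + 1 : {poly rat}) ^+ k.+1)%R = k.+2.
  by rewrite -[1]opprK -polyCN size_exp_XsubC.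
exists (k.+1%:R^-1 *: (('X + 1) ^+ k.+1 - (r + 1))); split.
- move=> n n0; rewrite hornerZ; apply: (mulfI k0); rewrite mulVKf//.
  rewrite hornerD hornerN horner_exp !hornerE natr1 -natrX power_sum_rec.
  rewrite big_ord_recr /= binSn !natrD natrM natr_sum horner_sum.
  have -> : \sum_(i < k) (('C(k.+1, i)%:R : rat) *: sval (IH i)).[n%:R] =
            \sum_(i < k) ('C(k.+1, i) * power_sum i n)%:R.
    apply: eq_bigr => j _; rewrite hornerZ natrM.
    by case: (IH j) => p /= [-> //].
  by rewrite [RHS]mulrC; move: (\sum_(i < k) _) => s; ring.
- rewrite coefZ -horner_coef0 hornerD hornerN horner_exp !hornerE expr1n.
  rewrite horner_sum big1 ?add0r ?subrr ?mulr0// => j _.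
  by rewrite hornerZ horner_coef0; case: (IH j) => p /= [_ -> _]; rewrite mulr0.
- by rewrite size_scale ?invr_eq0// size_polyDl ?size_polyN ?szX.
Qed.

Lemma power_sum_polyP (k : nat) :
  [/\ represents_power_sum k (power_sum_poly k), (power_sum_poly k)`_0 = 0
    & size (power_sum_poly k) = k.+2].
Proof.
have [p [hp p0 sp]] := power_sum_poly_exists k.
rewrite /power_sum_poly; case: xgetP => [q _ /= hq | /(_ p)]; last by [].
by rewrite (power_sum_poly_unique hq hp).
Qed.

(* Main.v *)
(** Let [I p] be the primitive of [p] vanishing at 0. Each of the four rules
    says that [q = k * I p + (1 - k * (I p)(1)) * x], that is, [q' - k * p] is
    constant, [q(0) = 0] and [q(1) = 1]. For power sums, differentiating
    [S_k(x + 1) - S_k(x) = (x + 1)^k] shows that [S_k' - k * S_{k-1}] has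
    period 1, and a periodic polynomial is constant. *)

Require Import Defs.
From HB Require Import structures.
From mathcomp Require Import all_boot all_order all_algebra.
From mathcomp Require Import all_classical all_reals all_analysis.
From mathcomp Require Import ring zify.

Set Implicit Arguments.
Unset Strict Implicit.
Unset Printing Implicit Defensive.

Import Order.TTheory GRing.Theory Num.Theory.
Import numFieldNormedType.Exports.

Local Open Scope ring_scope.

(** * Formal antiderivatives *)

(* The constant coefficient is [p`_0 / 0 = 0]. *)
Definition primitive (F : numFieldType) (p : {poly F}) : {poly F} :=
  \poly_(j < (size p).+1) (p`_j.-1 / j%:R).

Lemma coef_primitive0 (F : numFieldType) (p : {poly F}) : (primitive p)`_0 = 0.
Proof. by rewrite coef_poly invr0 mulr0. Qed.

Lemma coef_primitiveS (F : numFieldType) (p : {poly F}) j :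
  (primitive p)`_j.+1 = p`_j / j.+1%:R.
Proof.
by rewrite coef_poly ltnS /=; case: ltnP => // h; rewrite nth_default// mul0r.
Qed.

Lemma deriv_primitive (F : numFieldType) (p : {poly F}) : (primitive p)^`() = p.
Proof.
by apply/polyP => j; rewrite coef_deriv coef_primitiveS -[LHS]mulr_natr mulfVK.
Qed.

(** The degree-one term comes from the constant coefficient of [p], which vanishes; the remaining
    sum has the index range of [star]. *)
Lemma primitive_sum (F : numFieldType) (p : {poly F}) k :
  p`_0 = 0 -> (size p <= k.+1)%N ->
  primitive p = \sum_(1 <= j < k.+1) (p`_j / j.+1%:R) *: 'X^(j.+1).
Proof.
move=> p0 sp; apply/polyP => -[|i].
  by rewrite coef_primitive0 coef_sum big1// => j _; rewrite coefZ coefXn mulr0.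
rewrite coef_primitiveS.
have -> : \sum_(1 <= j < k.+1) (p`_j / j.+1%:R) *: 'X^(j.+1) =
          \sum_(0 <= j < k.+1) (p`_j / j.+1%:R) *: 'X^(j.+1).
  by rewrite [RHS]big_nat_recl// p0 mul0r scale0r add0r big_add1.
rewrite big_mkord coef_sumMXn.
case: (ltnP i k.+1) => ik; last first.
  rewrite nth_default ?(leq_trans sp)// mul0r big1// => j /eqP[ji].
  by move: ik; rewrite -ji leqNgt ltn_ord.
by rewrite (big_pred1 (Ordinal ik))// => j /=; rewrite eqSS.
Qed.

(** * Real integrals of rational polynomials *)

Lemma Rintegral_horner_deriv (R : realType) (a b : R) (p : {poly R}) :
  a <= b -> \int[lebesgue_measure]_(t in `[a, b]%classic) p^`().[t]
            = p.[b] - p.[a].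
Proof.
(* The fundamental theorem of calculus is applied for [a < b]; the degenerate interval is a single
   point, of measure zero. *)
rewrite le_eqVlt => /predU1P[<-|ab].
  by rewrite set_itv1 Rintegral_set1 subrr.
rewrite /Rintegral (@continuous_FTC2 _ _ (horner p))// -?EFinB//.
- by apply: continuous_subspaceT => x; exact: continuous_horner.
- split => [x _||]; first exact: derivable_horner.
  + by apply: cvg_at_right_filter; exact: continuous_horner.
  + by apply: cvg_at_left_filter; exact: continuous_horner.
- by move=> x _; rewrite derivE.
Qed.

Lemma oriented_integral_evalR (R : realType) (p : {poly rat}) (x : R) :
  oriented_integral 0 x (@evalR R p) = evalR (primitive p) x.
Proof.
have -> : @evalR R p = fun t => (map_poly ratr (primitive p))^`().[t].
  by apply/funext => t; rewrite deriv_map deriv_primitive.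
have P0 : (map_poly (@ratr R) (primitive p)).[0] = 0.
  by rewrite horner_coef0 coef_map coef_primitive0 raddf0.
rewrite /oriented_integral; case: leP => x0.
  by rewrite Rintegral_horner_deriv// P0 subr0.
by rewrite Rintegral_horner_deriv ?ltW// P0 sub0r opprK.
Qed.

Lemma evalR_inj (R : realType) (p q : {poly rat}) :
  (forall x : R, evalR p x = evalR q x) -> p = q.
Proof.
move=> pq; apply: poly_eq_nat => n _; apply: (fmorph_inj (@ratr R)).
by rewrite -!horner_map; exact: pq.
Qed.

(** * The four rules as one map on polynomials *)

(** The common normal form, over the rationals: each rule is compared with it alone, and the
    equivalences follow by transitivity. *)
Definition next_power_sum (k : nat) (p : {poly rat}) : {poly rat} :=
  k%:R *: primitive p + (1 - k%:R * (primitive p).[1]) *: 'X.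

Lemma integration_formulaP (R : realType) k p q :
  integration_formula R k p q <-> q = next_power_sum k p.
Proof.
have next_eval (x : R) : evalR (next_power_sum k p) x =
    k%:R * evalR (primitive p) x + (1 - k%:R * evalR (primitive p) 1) * x.
  rewrite /evalR rmorphD/= !map_polyZ hornerD !hornerZ map_polyX hornerX.
  by rewrite rmorphB rmorphM rmorph1 rmorph_nat -horner_map rmorph1.
split=> [h|->].
  by apply: (@evalR_inj R) => x; rewrite next_eval h !oriented_integral_evalR.
by move=> x; rewrite next_eval !oriented_integral_evalR.
Qed.

Lemma horner_next k p x : has_form k p ->
  (next_power_sum k p).[x] =
    \sum_(1 <= j < k.+1) k%:R / j.+1%:R * p`_j * x ^+ j.+1
    + (1 - k%:R * \sum_(1 <= j < k.+1) p`_j / j.+1%:R) * x.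
Proof.
move=> [p0 sp]; rewrite hornerD !hornerZ hornerX (primitive_sum p0 sp).
rewrite !horner_sum; congr (_ + (1 - _ * _) * _).
  by rewrite mulr_sumr; apply: eq_bigr => j _; rewrite hornerZ hornerXn; ring.
by apply: eq_bigr => j _; rewrite hornerZ hornerXn expr1n mulr1.
Qed.

(** Collecting the [-n] parts of [star] turns the coefficient of the leading [n] into
    [1 - k * (primitive p)(1)]. *)
Lemma abramovichP k p q : has_form k p ->
  abramovich k p q <-> q = next_power_sum k p.
Proof.
move=> fp.
have star_eval x : x + k%:R * (star k p).[x] = (next_power_sum k p).[x].
  have -> : (star k p).[x] = \sum_(1 <= j < k.+1) p`_j / j.+1%:R * x ^+ j.+1
                             - (\sum_(1 <= j < k.+1) p`_j / j.+1%:R) * x.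
    rewrite horner_sum mulr_suml -sumrB; apply: eq_bigr => j _.
    by rewrite !hornerZ hornerD hornerN hornerXn hornerX; ring.
  rewrite horner_next//.
  have -> : \sum_(1 <= j < k.+1) k%:R / j.+1%:R * p`_j * x ^+ j.+1 =
            k%:R * \sum_(1 <= j < k.+1) p`_j / j.+1%:R * x ^+ j.+1.
    by rewrite mulr_sumr; apply: eq_bigr => j _; ring.
  by ring.
split=> [h|-> n _]; last by rewrite star_eval.
by apply: poly_eq_nat => n n0; rewrite h.
Qed.

(** Coefficients are compared in degree 0, 1 and at least 2. In degree 1 the primitive contributes
    nothing, since [p] has no constant term. *)
Lemma bloom_owensP k p q : has_form k p ->
  bloom_owens k p q <-> q = next_power_sum k p.
Proof.
move=> fp; have [p0 sp] := fp.
have coefSS j : (next_power_sum k p)`_j.+2 = k%:R / j.+2%:R * p`_j.+1.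
  rewrite coefD !coefZ coefX mulr0 addr0 coef_primitiveS; ring.
(* An arbitrary [r] is taken because the identity serves both for [q] and for
   [next_power_sum k p]. *)
have sum_eq (r : {poly rat}) :
    (forall j, (2 <= j <= k.+1)%N -> r`_j = k%:R / j%:R * p`_j.-1) ->
    \sum_(2 <= j < k.+2) r`_j = k%:R * (primitive p).[1].
  move=> rE; rewrite (primitive_sum p0 sp) horner_sum mulr_sumr big_add1.
  apply: eq_big_nat => j /andP[j1 jk].
  by rewrite rE ?ltnS ?j1// hornerZ hornerXn expr1n; ring.
have coef_next0 : (next_power_sum k p)`_0 = 0.
  by rewrite coefD !coefZ coefX coef_primitive0 !mulr0 addr0.
have coef_next1 : (next_power_sum k p)`_1 = 1 - k%:R * (primitive p).[1].
  by rewrite coefD !coefZ coefX coef_primitiveS p0 mul0r mulr0 add0r mulr1.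
split=> [[[q0 sq] qE q1]|->].
  apply/polyP => -[|[|j]]; rewrite ?coef_next0// ?coef_next1 ?coefSS.
    by rewrite q1 sum_eq.
  have [jk|jk] := leqP j.+2 k.+1; first exact: qE.
  by rewrite !nth_default ?mulr0 ?(leq_trans sp) ?(leq_trans sq).
have nE j : (2 <= j <= k.+1)%N ->
    (next_power_sum k p)`_j = k%:R / j%:R * p`_j.-1.
  by case: j => [|[|j]]// _.
split=> //; last by rewrite coef_next1 sum_eq.
split=> //; apply/leq_sizeP => -[|[|j]]//; rewrite ltnS => kj.
by rewrite coefSS nth_default ?mulr0// (leq_trans sp).
Qed.

(** The family [b] lists the coefficients of [p] from the top degree down, so the sums are those of
    [horner_next] read backwards. *)
Lemma budin_cantorP k p q : has_form k.+1 p ->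
  budin_cantor k p q <-> q = next_power_sum k.+1 p.
Proof.
move=> fp; have [p0 sp] := fp.
have rev_sum (F : nat -> rat) :
    \sum_(1 <= i < k.+2) F (k + 2 - i)%N = \sum_(1 <= j < k.+2) F j.
  rewrite [RHS]big_nat_rev /=; apply: eq_big_nat => i _.
  by rewrite addSn subSS add0n addn2.
have p_eval x : p.[x] = \sum_(1 <= j < k.+2) p`_j * x ^+ j.
  rewrite (horner_coef_wide _ sp) -(big_mkord xpredT (fun j => p`_j * x ^+ j)).
  by rewrite big_nat_recl// p0 mul0r add0r big_add1.
have exp3 i : (1 <= i < k.+2)%N -> (k + 3 - i = (k + 2 - i).+1)%N.
  by case/andP=> _ ik; rewrite -subSn ?addnS// addn0 ltnW.
have next_eval x : (next_power_sum k.+1 p).[x] =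
    \sum_(1 <= i < k.+2)
       (k.+1%:R / (k + 3 - i)%:R) * p`_(k + 2 - i) * x ^+ (k + 3 - i)
    + (1 - k.+1%:R * \sum_(1 <= i < k.+2) p`_(k + 2 - i) / (k + 3 - i)%:R) * x.
  rewrite horner_next//; congr (_ + (1 - _ * _) * _); rewrite -rev_sum;
    by apply: eq_big_nat => i ik; rewrite exp3.
split=> [h|->].
  apply: poly_eq_nat => n n0; rewrite next_eval.
  (* Unification takes for [b i] the coefficient of [p] in degree [k + 2 - i]. *)
  by apply: h => // m m0; rewrite p_eval -rev_sum.
move=> b pb n n0; rewrite next_eval.
(* Any admissible [b] is forced: agreement at the positive integers is a polynomial identity, and
   distinct indices give distinct exponents. *)
have bE i : (1 <= i < k.+2)%N -> p`_(k + 2 - i) = b i.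
  move=> ik.
  have -> : p = \sum_(1 <= j < k.+2) b j *: 'X^(k + 2 - j).
    apply: poly_eq_nat => m m0; rewrite pb// horner_sum.
    by apply: eq_bigr => j _; rewrite hornerZ hornerXn.
  rewrite coef_sum (bigD1_seq i) ?mem_index_iota ?iota_uniq//=.
  rewrite coefZ coefXn eqxx mulr1 big_nat_cond big1 ?addr0// => j.
  case/andP=> jk ji; rewrite coefZ coefXn.
  case: eqP => [e|]; last by rewrite mulr0.
  by case/eqP: ji; move: ik jk e; lia.
congr (_ + (1 - _ * _) * _); by apply: eq_big_nat => i ik; rewrite bE.
Qed.

(** * The derivative and normalization of power sum polynomials *)

(** Periodicity carries the value at 0 to every natural number, and these values determine the
    polynomial. *)
Lemma periodic_poly_const (p : {poly rat}) : p \Po ('X + 1) = p -> p = p.[0]%:P.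
Proof.
move=> pp; apply: poly_eq_nat => n _; rewrite hornerC.
elim: n => // n <-; rewrite -[in RHS]pp horner_comp !hornerE.
by rewrite natr1.
Qed.

Lemma power_sum_poly_succ k :
  power_sum_poly k \Po ('X + 1) = power_sum_poly k + ('X + 1) ^+ k.
Proof.
have [Sk _ _] := power_sum_polyP k.
apply: poly_eq_nat => n n0; rewrite horner_comp [RHS]hornerD horner_exp.
by rewrite !hornerE natr1 !Sk// /power_sum big_nat_recr//= natrD natrX.
Qed.

Lemma power_sum_poly1 k : (power_sum_poly k).[1] = 1.
Proof.
have [/(_ 1 isT) -> _ _] := power_sum_polyP k.
by rewrite /power_sum big_nat1 exp1n.
Qed.

Lemma deriv_power_sum_poly k :
  exists c, (power_sum_poly k.+1)^`() = k.+1%:R *: power_sum_poly k + c%:P.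
Proof.
pose D := (power_sum_poly k.+1)^`() - k.+1%:R *: power_sum_poly k.
suff /periodic_poly_const DE : D \Po ('X + 1) = D.
  by exists D.[0]; rewrite -DE addrC subrK.
have dX : ('X + 1 : {poly rat})^`() = 1 by rewrite derivD derivX derivC addr0.
have := congr1 deriv (power_sum_poly_succ k.+1).
rewrite deriv_comp dX mulr1 derivD deriv_exp dX mul1r /= => e.
(* Under the shift both terms of [D] grow by [(k + 1) * (x + 1)^k], and the increments cancel. *)
rewrite /D comp_polyB comp_polyZ e power_sum_poly_succ scalerDr -scaler_nat.
by rewrite opprD addrACA subrr addr0.
Qed.

Lemma has_form_power_sum_poly k : has_form k.+1 (power_sum_poly k).
Proof. by have [_ S0 sS] := power_sum_polyP k; split; rewrite ?sS. Qed.

(** Integrating [deriv_power_sum_poly] leaves two unknowns: the value at 0 fixes the integration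
    constant, the value at 1 fixes [c]. *)
Lemma power_sum_poly_next k :
  power_sum_poly k.+1 = next_power_sum k.+1 (power_sum_poly k).
Proof.
have [c dS] := deriv_power_sum_poly k.
have [S0 _] := has_form_power_sum_poly k.+1.
have SE :
    power_sum_poly k.+1 = k.+1%:R *: primitive (power_sum_poly k) + c *: 'X.
  apply/polyP => -[|j]; rewrite coefD !coefZ coefX.
    by rewrite S0 coef_primitive0 !mulr0 addr0.
  have j0 : j.+1%:R != 0 :> rat by rewrite pnatr_eq0.
  apply: (mulIf j0); rewrite [LHS]mulr_natr -coef_deriv dS coefD coefZ coefC.
  rewrite coef_primitiveS mulrDl mulrA mulfVK//; congr (_ + _).
  by case: j {j0} => [|j]; rewrite ?mulr1// mulr0 mul0r.
rewrite [LHS]SE; congr (_ + _ *: _).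
have := power_sum_poly1 k.+1; rewrite SE hornerD !hornerZ hornerX mulr1.
by move=> /(canRL (addKr _)) ->; rewrite addrC.
Qed.

Lemma power_sum_poly0 : power_sum_poly 0 = 'X.
Proof.
apply: poly_eq_nat => n n0; have [-> // _ _] := power_sum_polyP 0.
by rewrite hornerX /power_sum big_const_nat iter_addn_0 mul1n subn1.
Qed.

Theorem mainTheorem1 (R : realType) :
  power_sum_poly 0 = 'X /\
  forall k : nat, (0 < k)%N ->
    [/\ (* the four formulas are valid for the power sum polynomials *)
        [/\ abramovich k (power_sum_poly k.-1) (power_sum_poly k),
            integration_formula R k (power_sum_poly k.-1) (power_sum_poly k),
            bloom_owens k (power_sum_poly k.-1) (power_sum_poly k)
          & budin_cantor k.-1 (power_sum_poly k.-1) (power_sum_poly k)],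
        (* each of them determines S_k from S_{k-1} *)
        (forall q : {poly rat},
           [\/ abramovich k (power_sum_poly k.-1) q,
               integration_formula R k (power_sum_poly k.-1) q,
               bloom_owens k (power_sum_poly k.-1) q
             | budin_cantor k.-1 (power_sum_poly k.-1) q] ->
           q = power_sum_poly k)
      & (* they are equivalent as rules turning coefficients into coefficients *)
        forall p q : {poly rat}, has_form k p ->
          [<-> abramovich k p q;
               integration_formula R k p q;
               bloom_owens k p q;
               budin_cantor k.-1 p q]].
Proof.
split=> [|[//|k] _]; first exact: power_sum_poly0.
have fS := has_form_power_sum_poly k; have SE := power_sum_poly_next k.
split=> /=.
- by split; [apply/abramovichP|apply/integration_formulaP|
             apply/bloom_owensP|apply/budin_cantorP].
- by move=> q [/(abramovichP _ fS)|/integration_formulaP|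
               /(bloom_owensP _ fS)|/(budin_cantorP _ fS)] ->.
(* Each implication of the cycle passes through [q = next_power_sum k.+1 p]. *)
- move=> p q fp; tfae.
  + by move=> /(abramovichP _ fp)/integration_formulaP.
  + by move=> /integration_formulaP/(bloom_owensP _ fp).
  + by move=> /(bloom_owensP _ fp)/(budin_cantorP _ fp).
  + by move=> /(budin_cantorP _ fp)/(abramovichP _ fp).
Qed.
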